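(* Let $t,s,u,r\ge 1$ be integers, let $P_1,P_2>0$, and let $\mathbf{H}_0\in\mathbb{C}^{r\times t}$, $\mathbf{H}_1\in\mathbb{C}^{s\times t}$, $\mathbf{H}_2\in\mathbb{C}^{r\times u}$ be given. For a symbol rate $R>0$ and a matrix $\mathbf{X}\in\mathbb{C}^{u\times s}$ define $$C_{\mathsf{OSTBC}}(\mathbf{X})=R\log_2\Big\{1+\frac{P_1}{tR}\operatorname{tr}\Big[\mathbf{H}_0^{H}\mathbf{H}_0+\mathbf{H}_1^{H}\mathbf{X}^{H}\mathbf{H}_2^{H}\big(\mathbf{I}_r+\mathbf{H}_2\mathbf{X}\mathbf{X}^{H}\mathbf{H}_2^{H}\big)^{-1}\mathbf{H}_2\mathbf{X}\mathbf{H}_1\Big]\Big\}.$$ Define $$\check{\mathbf{A}}=\mathbf{H}_1\mathbf{H}_1^{H},\qquad \check{\mathbf{B}}=\mathbf{H}_2^{H}\mathbf{H}_2,\qquad \mathbf{C}=\mathbf{I}_s+\frac{P_1}{t}\mathbf{H}_1\mathbf{H}_1^{H}.$$ Let $\rho_B=\operatorname{rank}(\check{\mathbf{B}})=\operatorname{rank}(\mathbf{H}_2)$ and $\rho=\min(s,\rho_B)$. Let $\alpha_1\ge\dots\ge\alpha_s$ be the eigenvalues of $\check{\mathbf{A}}$ with corresponding orthonormal eigenvectors $\mathbf{a}_1,\dots,\mathbf{a}_s\in\mathbb{C}^s$, and let $\mu_1\ge\dots\ge\mu_{\rho_B}>0$ be the positive eigenvalues of $\check{\mathbf{B}}$ with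 corresponding orthonormal eigenvectors $\mathbf{b}_1,\dots,\mathbf{b}_{\rho_B}\in\mathbb{C}^u$. For $i=1,\dots,\rho$ set $\beta_i=\mathbf{a}_i^{H}\mathbf{C}\mathbf{a}_i/\mu_i$. Let $(x_1,\dots,x_\rho)$ be a solution of the optimization problem $$\min_{x_1,\dots,x_\rho}\;\sum_{i=1}^{\rho}\frac{\alpha_i}{1+x_i}\quad\text{s.t.}\quad\sum_{i=1}^{\rho}\beta_i x_i\le P_2,\ \ x_i\ge 0,\ i=1,\dots,\rho.$$ Then the matrix $$\mathbf{X}=\widetilde{\mathbf{U}}_B\widetilde{\boldsymbol{\Lambda}}_B^{-1/2}\widetilde{\boldsymbol{\Lambda}}^{1/2}\widetilde{\mathbf{U}}_A^{H}=\sum_{i=1}^{\rho}\sqrt{\frac{x_i}{\mu_i}}\;\mathbf{b}_i\mathbf{a}_i^{H},$$ where $\widetilde{\mathbf{U}}_B=[\mathbf{b}_1,\dots,\mathbf{b}_{\rho_B}]$, $\widetilde{\boldsymbol{\Lambda}}_B=\mathrm{diag}(\mu_1,\dots,\mu_{\rho_B})$, $\widetilde{\boldsymbol{\Lambda}}=\mathrm{diag}(x_1,\dots,x_\rho,0,\dots,0)$ ($\rho_B\times\rho_B$) and $\widetilde{\mathbf{U}}_A$ has columns $\mathbf{a}_1,\mathbf{a}_2,\dots$, maximizes $C_{\mathsf{OSTBC}}(\mathbf{X})$ (for every $R>0$) over all $\mathbf{X}\in\mathbb{C}^{u\times s}$ subject to $\operatorname{tr}\{\mathbf{X}\mathbf{C}\mathbf{X}^{H}\}\le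 P_2$.
   Context: This models a two-hop amplify-and-forward MIMO relay network with a direct link: source with $t$ antennas transmitting power $P_1$, destination with $r$ antennas, relay with $s$ receive and $u$ transmit antennas applying the relay transform matrix $\mathbf{X}$; $\mathbf{H}_0,\mathbf{H}_1,\mathbf{H}_2$ are the source–destination, source–relay and relay–destination channel matrices, all noises are i.i.d. unit-variance circularly-symmetric complex Gaussian. $C_{\mathsf{OSTBC}}$ is the capacity achievable with orthogonal space–time block codes of symbol rate $R$, and $\operatorname{tr}\{\mathbf{X}\mathbf{C}\mathbf{X}^H\}$ is the average relay transmit power. $(\cdot)^H$ denotes conjugate transpose. *)

(* Defs.v *)
From HB Require Import structures.
From mathcomp Require Import all_boot all_order all_algebra.
From mathcomp Require Import complex.
From mathcomp Require Import all_classical all_reals all_analysis.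
Set Implicit Arguments. Unset Strict Implicit. Unset Printing Implicit Defensive.
Import Order.TTheory GRing.Theory Num.Theory.
Local Open Scope ring_scope.
Local Open Scope complex_scope.

Definition ctmx (R : realType) m n (A : 'M[R[i]]_(m, n)) : 'M[R[i]]_(n, m) :=
  (map_mx (@conjc R) A)^T.

Definition log2 (R : realType) (x : R) : R := ln x / ln 2.

(* C_OSTBC(X); the trace is a real number (Hermitian PSD argument), we take
   its real part. *)
Definition C_OSTBC (R : realType) (t s u r : nat) (P1 Rate : R)
  (H0 : 'M[R[i]]_(r, t)) (H1 : 'M[R[i]]_(s, t)) (H2 : 'M[R[i]]_(r, u))
  (X : 'M[R[i]]_(u, s)) : R :=
  Rate * log2 (1 + P1 / (t%:R * Rate) *
    complex.Re (\tr (ctmx H0 *m H0 +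
             ctmx H1 *m ctmx X *m ctmx H2 *m
               invmx (1%:M + H2 *m X *m ctmx X *m ctmx H2) *m H2 *m X *m H1))).

Definition Cmat (R : realType) (t s : nat) (P1 : R) (H1 : 'M[R[i]]_(s, t))
  : 'M[R[i]]_s :=
  1%:M + (P1 / t%:R)%:C *: (H1 *m ctmx H1).

(* average relay transmit power tr{X C X^H} (real part; it is real) *)
Definition relay_power (R : realType) (u s : nat) (X : 'M[R[i]]_(u, s))
  (C : 'M[R[i]]_s) : R :=
  complex.Re (\tr (X *m C *m ctmx X)).

(* Main.v *)
Require Import Defs.
From HB Require Import structures.
From mathcomp Require Import all_boot all_order all_algebra.
From mathcomp Require Import all_fingroup complex ring lra zify.
From mathcomp Require Import all_classical all_reals all_analysis.
Set Implicit Arguments. Unset Strict Implicit. Unset Printing Implicit Defensive.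
Import Order.TTheory GRing.Theory Num.Theory.
Local Open Scope ring_scope.
Local Open Scope complex_scope.

(** In the eigenbasis [U] of [H1 H1^H] put [Y = X U Gamma^(1/2)], where [Gamma]
is the diagonal form of [C], and [M = Y^H H2^H H2 Y]. With [c = P1 / t], the
trace in the capacity equals, up to the constant [tr (H0^H H0)],
[sum_i alpha_i - c^-1 F(M)] with [F(M) = tr ((Gamma^2 - Gamma) (Gamma + M)^-1)],
and the relay power is [tr (Y^H Y)]. Let [m_1 >= m_2 >= ...] be the eigenvalues
of [M].

The value [F(M)] is at least [F(diag m)]. Indeed, with
[P = Gamma - 1/2] and [Q = M + 1/2] it equals
[tr (P^2 (P + Q)^-1) - 1/4 tr ((P + Q)^-1)], and, up to a term [tr P], the first
summand is [- tr ((P^-1 + Q^-1)^-1)]; convexity of the inverse and von Neumann's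
trace inequality show that the trace of the inverse of a sum of two positive
matrices with given spectra is largest when they are simultaneously diagonal
with similarly ordered eigenvalues.

Likewise [tr (Y^H Y) >= sum_i m_i / mu_i] by a rearrangement inequality, and
[m_i = 0] beyond the rank of [H2^H H2]. So [y_i = m_i / gamma_i] is feasible in
the scalar problem and does at least as well as [X]. *)

(** * Complex matrices with conjugate transpose *)

Section ConjugateTranspose.
Context {R : realType}.
Implicit Types z w : R[i].

Lemma ctmxE m n (A : 'M[R[i]]_(m, n)) i j : ctmx A i j = conjc (A j i).
Proof. by rewrite !mxE. Qed.

Lemma ctmxM m n p (A : 'M[R[i]]_(m, n)) (B : 'M[R[i]]_(n, p)) :
  ctmx (A *m B) = ctmx B *m ctmx A.
Proof. by rewrite /ctmx map_mxM trmx_mul. Qed.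

Lemma ctmxK m n (A : 'M[R[i]]_(m, n)) : ctmx (ctmx A) = A.
Proof. by apply/matrixP => i j; rewrite !ctmxE conjcK. Qed.

Lemma ctmxD m n (A B : 'M[R[i]]_(m, n)) : ctmx (A + B) = ctmx A + ctmx B.
Proof. by rewrite /ctmx map_mxD linearD. Qed.

Lemma ctmxN m n (A : 'M[R[i]]_(m, n)) : ctmx (- A) = - ctmx A.
Proof. by rewrite /ctmx map_mxN linearN. Qed.

Lemma ctmx1 n : ctmx (1%:M : 'M[R[i]]_n) = 1%:M.
Proof. by rewrite /ctmx map_mx1 trmx1. Qed.

Lemma cReD z w : complex.Re (z + w) = complex.Re z + complex.Re w.
Proof. by case: z w => ? ? []. Qed.

Lemma cReN z : complex.Re (- z) = - complex.Re z.
Proof. by case: z. Qed.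

Lemma cRe_sum (I : Type) (r : seq I) (P : pred I) (F : I -> R[i]) :
  complex.Re (\sum_(i <- r | P i) F i) = \sum_(i <- r | P i) complex.Re (F i).
Proof. by apply: (big_morph _ cReD). Qed.

Lemma cReMl (x : R) z : complex.Re (x%:C * z) = x * complex.Re z.
Proof. by case: z => a b /=; rewrite mul0r subr0. Qed.

(** Squared modulus as an element of [R]: these values serve as the weights of the averages
    below. *)
Definition sqnorm z : R := complex.Re z ^+ 2 + complex.Im z ^+ 2.

Lemma mulcJ_sqnorm z : conjc z * z = (sqnorm z)%:C.
Proof.
by case: z => a b; apply/eqP; rewrite eq_complex /= /sqnorm /=; apply/andP;
  split; apply/eqP; ring.
Qed.

Lemma sqnorm_ge0 z : 0 <= sqnorm z.
Proof. by rewrite addr_ge0 ?sqr_ge0. Qed.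

Lemma sqnormJ z : sqnorm (conjc z) = sqnorm z.
Proof. by case: z => a b; rewrite /sqnorm /= sqrrN. Qed.

Lemma sqnormM z w : sqnorm (z * w) = sqnorm z * sqnorm w.
Proof. by case: z w => a b [c d]; rewrite /sqnorm /=; ring. Qed.

Lemma sqnorm_real (x : R) : sqnorm x%:C = x ^+ 2.
Proof. by rewrite /sqnorm /= expr0n addr0. Qed.

(** Spectra are real functions embedded in complex diagonal matrices, so that sorting and
    inequalities stay in [R]. *)
Definition rdiag {n} (d : 'I_n -> R) : 'M[R[i]]_n := diag_mx (\row_j (d j)%:C).

Lemma rdiagE n (d : 'I_n -> R) i j : rdiag d i j = (d i *+ (i == j))%:C.
Proof. by rewrite !mxE; case: eqP => [->|]; rewrite ?mulr1n ?mulr0n. Qed.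

Lemma rdiagM n (d e : 'I_n -> R) :
  rdiag d *m rdiag e = rdiag (fun i => d i * e i).
Proof.
rewrite /rdiag mulmx_diag; congr diag_mx; apply/rowP => j.
by rewrite !mxE rmorphM.
Qed.

Lemma rdiagD n (d e : 'I_n -> R) :
  rdiag d + rdiag e = rdiag (fun i => d i + e i).
Proof. by apply/matrixP => i j; rewrite mxE !rdiagE mulrnDl rmorphD. Qed.

Lemma rdiag1 n : rdiag (fun _ : 'I_n => 1) = 1%:M.
Proof.
apply/matrixP => i j; rewrite rdiagE mxE.
by case: eqP => _; rewrite ?mulr1n ?mulr0n.
Qed.

Lemma ctmx_rdiag n (d : 'I_n -> R) : ctmx (rdiag d) = rdiag d.
Proof.
apply/matrixP => i j; rewrite ctmxE !rdiagE conjc_real eq_sym.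
by case: eqP => [->|].
Qed.

Lemma eq_rdiag n (d e : 'I_n -> R) : d =1 e -> rdiag d = rdiag e.
Proof. by move=> de; congr rdiag; apply/funext. Qed.

Lemma mulmx_rdiagE m n p (A : 'M[R[i]]_(m, n)) (d : 'I_n -> R)
    (B : 'M[R[i]]_(n, p)) i j :
  (A *m rdiag d *m B) i j = \sum_k (d k)%:C * (A i k * B k j).
Proof.
rewrite mxE; apply: eq_bigr => k _; rewrite mul_mx_diag !mxE.
by rewrite mulrCA mulrA.
Qed.

Lemma rdiag_scaleE m n (d : 'I_m -> R) (A : 'M[R[i]]_(m, n)) (e : 'I_n -> R) i j :
  (rdiag d *m A *m rdiag e) i j = (d i)%:C * A i j * (e j)%:C.
Proof. by rewrite mul_mx_diag mul_diag_mx !mxE. Qed.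

Lemma congr_rdiagE m n (W : 'M[R[i]]_(m, n)) (d : 'I_m -> R) i :
  (ctmx W *m rdiag d *m W) i i = (\sum_k d k * sqnorm (W k i))%:C.
Proof.
rewrite mulmx_rdiagE rmorph_sum; apply: eq_bigr => k _ /=.
by rewrite ctmxE mulcJ_sqnorm -rmorphM.
Qed.

Lemma gramE m n (W : 'M[R[i]]_(m, n)) i :
  (ctmx W *m W) i i = (\sum_k sqnorm (W k i))%:C.
Proof.
rewrite -[ctmx W]mulmx1 -rdiag1 congr_rdiagE.
by congr (_%:C); apply: eq_bigr => k _; rewrite mul1r.
Qed.

Definition retr {n} (A : 'M[R[i]]_n) : R := complex.Re (\tr A).

Lemma retrE n (A : 'M[R[i]]_n) : retr A = \sum_i complex.Re (A i i).
Proof. by rewrite /retr /mxtrace cRe_sum. Qed.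

Lemma retrD n (A B : 'M[R[i]]_n) : retr (A + B) = retr A + retr B.
Proof. by rewrite /retr mxtraceD cReD. Qed.

Lemma retrN n (A : 'M[R[i]]_n) : retr (- A) = - retr A.
Proof. by rewrite /retr linearN cReN. Qed.

Lemma retrC m n (A : 'M[R[i]]_(m, n)) (B : 'M[R[i]]_(n, m)) :
  retr (A *m B) = retr (B *m A).
Proof. by rewrite /retr mxtrace_mulC. Qed.

Lemma retr_rdiag n (d : 'I_n -> R) : retr (rdiag d) = \sum_i d i.
Proof. by rewrite retrE; apply: eq_bigr => i _; rewrite rdiagE eqxx. Qed.

Lemma retr_gram m n (W : 'M[R[i]]_(m, n)) :
  retr (ctmx W *m W) = \sum_j \sum_i sqnorm (W i j).
Proof. by rewrite retrE; apply: eq_bigr => j _; rewrite gramE. Qed.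

Lemma retr_gram_ge0 m n (W : 'M[R[i]]_(m, n)) : 0 <= retr (ctmx W *m W).
Proof.
rewrite retr_gram; apply: sumr_ge0 => j _; apply: sumr_ge0 => i _.
exact: sqnorm_ge0.
Qed.

Lemma rdiagV n (d : 'I_n -> R) : (forall i, d i != 0) ->
  rdiag d *m rdiag (fun i => (d i)^-1) = 1%:M.
Proof. by move=> dN0; rewrite rdiagM -rdiag1; apply: eq_rdiag => i; rewrite divff. Qed.

Lemma invmx_eq n (A B : 'M[R[i]]_n) : A *m B = 1%:M -> invmx A = B.
Proof.
move=> AB; have [Au _] := mulmx1_unit AB.
by rewrite -[B]mul1mx -(mulVmx Au) -mulmxA AB mulmx1.
Qed.

Lemma isometryC n (W : 'M[R[i]]_n) : ctmx W *m W = 1%:M -> W *m ctmx W = 1%:M.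
Proof. exact: mulmx1C. Qed.

(** Phrased as a product equal to [1%:M], which yields both invertibility and the value of
    [invmx]. *)
Lemma invmx_spectral n (W : 'M[R[i]]_n) (d : 'I_n -> R) :
  ctmx W *m W = 1%:M -> (forall i, d i != 0) ->
  (W *m rdiag d *m ctmx W) *m (W *m rdiag (fun i => (d i)^-1) *m ctmx W) = 1%:M.
Proof.
move=> WW dN0; rewrite !mulmxA -(mulmxA _ (ctmx W) W) WW mulmx1.
by rewrite -(mulmxA W) rdiagV // mulmx1 isometryC.
Qed.

(** The spectral theorem gives a unitary [S] and real eigenvalues in no particular order; permuting
    the rows of [S] along a sort of the indices orders them. *)
Lemma spectral_sorted n (A : 'M[R[i]]_n) : ctmx A = A ->
  exists (W : 'M[R[i]]_n) (d : 'I_n -> R),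
    [/\ ctmx W *m W = 1%:M, A = W *m rdiag d *m ctmx W
      & forall i j : 'I_n, (i <= j)%N -> d j <= d i].
Proof.
move=> AA.
have AE : A \is hermsymmx.
  apply/is_hermitianmxP; rewrite expr0 scale1r -{1}AA.
  by rewrite /ctmx map_trmx.
have := hermitian_spectral_diag_real AE => /mxOverP dreal.
have /orthomx_spectralP AD := hermitian_normalmx AE.
set S := spectralmx A in AD; set D := spectral_diag A in AD dreal.
have SU : S \is unitarymx by exact: spectral_unitarymx.
have invS : invmx S = ctmx S by rewrite invmx_unitary // /ctmx map_trmx.
have SS : S *m ctmx S = 1%:M by rewrite -invS mulmxV // unitarymx_unit.
pose f (i : 'I_n) := complex.Re (D 0 i).
pose ge_f := fun i j : 'I_n => f j <= f i.
pose s := sort ge_f (enum 'I_n).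
have ss : size s == n by rewrite size_sort size_enum_ord.
have s_sorted : sorted ge_f s.
  by apply: sort_sorted => i j; exact: le_total.
have us : uniq s by rewrite sort_uniq enum_uniq.
(* [p i] is the index of the eigenvalue in position [i] of the decreasing order. Since
   [A = S^H D S], column [j] of the witness is the conjugate of row [p j] of [S]. *)
pose p (i : 'I_n) : 'I_n := tnth (Tuple ss) i.
have p_inj : injective p.
  move=> i j /eqP; rewrite /p !(tnth_nth i) /= nth_uniq ?(eqP ss) //.
  by move/eqP/val_inj.
exists (\matrix_(i, j) conjc (S (p j) i)), (fun i => f (p i)).
set W := \matrix_(_, _) _.
have WE : W = ctmx (perm_mx (perm p_inj) *m S).
  by apply/matrixP => i j; rewrite ctmxE -row_permE !mxE permE.
split.
- rewrite WE ctmxK ctmxM mulmxA -(mulmxA _ S) SS mulmx1.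
  have -> : ctmx (perm_mx (perm p_inj)) = (perm_mx (perm p_inj) : 'M[R[i]]_n)^T.
    by rewrite /ctmx map_perm_mx.
  by rewrite tr_perm_mx -perm_mxM mulgV perm_mx1.
- rewrite {1}AD invS; apply/matrixP => i j.
  rewrite mulmx_rdiagE mul_mx_diag mxE (reindex_inj p_inj) /=.
  apply: eq_bigr => k _; rewrite !mxE conjcK /f RRe_real ?dreal //.
  by rewrite mulrCA mulrA.
- move=> i j ij; rewrite /p !(tnth_nth i) /=.
  apply: (sorted_leq_nth (leT := ge_f) _ _ i s_sorted) => //.
  + by move=> y x z; rewrite /ge_f => xy yz; exact: le_trans yz xy.
  + by move=> x; exact: lexx.
  + by rewrite inE (eqP ss).
  + by rewrite inE (eqP ss).
Qed.

Lemma rdiagN n (d : 'I_n -> R) : rdiag (fun i => - d i) = - rdiag d.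
Proof. by apply/matrixP => i j; rewrite [RHS]mxE !rdiagE mulNrn rmorphN. Qed.

Lemma rdiag_const n (x : R) : rdiag (fun _ : 'I_n => x) = x%:C%:M.
Proof. by apply/matrixP => i j; rewrite rdiagE mxE rmorphMn. Qed.

Lemma retrZ n (x : R) (A : 'M[R[i]]_n) : retr (x%:C *: A) = x * retr A.
Proof. by rewrite /retr mxtraceZ; exact: cReMl. Qed.

End ConjugateTranspose.

(** * Rearrangement inequalities *)

Section Rearrangement.
Context {R : realType}.

(* The potentials [u] and [v] solve the dual transportation problem: they
   satisfy [u i + v j <= m i * w j] with equality on the diagonal. *)
Lemma substochastic_rearrangement_nat n k (m w : nat -> R)
    (p : 'I_n -> 'I_k -> R) :
  (forall i : nat, 0 <= m i) -> (forall i : nat, (n <= i)%N -> m i = 0) ->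
  (forall i j : nat, (i <= j)%N -> m j <= m i) ->
  (forall j : nat, (j < k)%N -> 0 <= w j) ->
  (forall i j : nat, (i <= j < k)%N -> w i <= w j) ->
  (forall i j, 0 <= p i j) ->
  (forall i : 'I_n, m i != 0 -> \sum_j p i j = 1) ->
  (forall j, \sum_i p i j <= 1) ->
  \sum_(0 <= i < minn n k) m i * w i <= \sum_(i < n) \sum_(j < k) m i * w j * p i j.
Proof.
move=> m_ge0 m_out m_decr w_ge0 w_incr p_ge0 p_row p_col.
pose v j := - \sum_(j <= l < k.-1) m l * (w l.+1 - w l).
pose u i := if (i < k)%N then m i * w i - v i else 0.
have v_step_ge0 (l j : nat) : (j <= l < k.-1)%N -> 0 <= m l * (w l.+1 - w l).
  by move=> /andP[_ ?]; rewrite mulr_ge0 // subr_ge0 w_incr //; lia.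
have v_le0 (j : nat) : v j <= 0.
  rewrite /v oppr_le0 big_nat_cond; apply: sumr_ge0 => l; rewrite andbT.
  exact: v_step_ge0.
have v_out (j : nat) : m j = 0 -> v j = 0.
  move=> mj; rewrite /v big_nat big1 ?oppr0 // => l /andP[jl _].
  have -> : m l = 0; last by rewrite mul0r.
  by apply/eqP; rewrite eq_le m_ge0 -mj m_decr.
have dual (i j : nat) : (j < k)%N -> u i + v j <= m i * w j.
  move=> jk; rewrite /u; case: ltnP => ik; last first.
    by rewrite add0r (le_trans (v_le0 j)) // mulr_ge0 // w_ge0.
  have telescope (a b : nat) : (a <= b)%N ->
      \sum_(a <= l < b) m i * (w l.+1 - w l) = m i * (w b - w a).
    by move=> ab; rewrite -mulr_sumr telescope_sumr.
  (* [v i] and [v j] differ by a sum over the indices between [i] and [j]. Replacing each [m l]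
     there by [m i] makes it telescope, and monotonicity of [m] gives the needed direction on either
     side. *)
  case: (leqP i j) => ij.
    have vE : v i = - \sum_(i <= l < j) m l * (w l.+1 - w l) + v j.
      by rewrite /v (@big_cat_nat _ _ _ j) ?opprD //=; lia.
    have : \sum_(i <= l < j) m l * (w l.+1 - w l) <= m i * (w j - w i).
      rewrite -telescope // ler_sum_nat // => l /andP[? ?].
      by rewrite ler_wpM2r ?m_decr // subr_ge0 w_incr //; lia.
    by rewrite vE mulrBr; lra.
  have vE : v j = - \sum_(j <= l < i) m l * (w l.+1 - w l) + v i.
    by rewrite /v (@big_cat_nat _ _ _ i) ?opprD //=; lia.
  have : m i * (w i - w j) <= \sum_(j <= l < i) m l * (w l.+1 - w l).
    rewrite -telescope; last lia.
    rewrite ler_sum_nat // => l /andP[? ?].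
    by rewrite ler_wpM2r ?m_decr ?subr_ge0 ?w_incr //; lia.
  by rewrite vE mulrBr; lra.
(* The dual objective is the diagonal sum: [u] vanishes from [k] on by definition, [v] from [n] on
   because [m] does. *)
have -> : \sum_(0 <= i < minn n k) m i * w i = \sum_(i < n) u i + \sum_(j < k) v j.
  rewrite -(big_mkord xpredT u) -(big_mkord xpredT v).
  rewrite (@big_cat_nat _ _ _ (minn n k) 0 n) ?geq_minl //=.
  rewrite (@big_cat_nat _ _ _ (minn n k) 0 k) ?geq_minr //=.
  rewrite [X in _ + X + _]big_nat_cond [X in _ + X + _]big1; last first.
    by move=> i; rewrite /u andbT => /andP[? ?]; rewrite ifN //; lia.
  rewrite [X in _ + (_ + X)]big_nat_cond [X in _ + (_ + X)]big1; last first.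
    by move=> i; rewrite andbT => /andP[? ?]; apply/v_out/m_out; lia.
  rewrite !addr0 -big_split /=; apply: eq_big_nat => i /andP[_ ik].
  by rewrite /u ifT ?subrK //; lia.
apply: (@le_trans _ _ (\sum_(i < n) \sum_(j < k) (u i + v j) * p i j)); last first.
  apply: ler_sum => i _; apply: ler_sum => j _.
  by rewrite ler_wpM2r ?dual.
have -> : \sum_(i < n) \sum_(j < k) (u i + v j) * p i j
        = \sum_(i < n) u i * \sum_j p i j + \sum_(j < k) v j * \sum_i p i j.
  have -> : \sum_(j < k) v j * \sum_i p i j = \sum_(i < n) \sum_(j < k) v j * p i j.
    by rewrite exchange_big; apply: eq_bigr => j _; rewrite mulr_sumr.
  rewrite -big_split; apply: eq_bigr => i _ /=.
  by rewrite mulr_sumr -big_split; apply: eq_bigr => j _; rewrite mulrDl.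
(* Rows with [m i = 0] have [u i = 0], so only rows of sum one count; a column sum below one can
   only raise the term of [v j <= 0]. *)
apply: lerD.
  apply: ler_sum => i _; have [mi0|/p_row->] := eqVneq (m i) 0; last by rewrite mulr1.
  have -> : u i = 0; last by rewrite mul0r.
  by rewrite /u mi0 mul0r v_out // subr0 if_same.
apply: ler_sum => j _; rewrite -[leLHS]mulr1.
by rewrite ler_wnM2l.
Qed.

(** Padding [m] with zeros keeps it nonincreasing because [m] is nonnegative, so the version indexed
    by natural numbers applies. *)
Lemma substochastic_rearrangement n k (m : 'I_n -> R) (w : 'I_k -> R)
    (p : 'I_n -> 'I_k -> R) :
  (forall i, 0 <= m i) ->
  (forall i j : 'I_n, (i <= j)%N -> m j <= m i) ->
  (forall j, 0 <= w j) ->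
  (forall i j : 'I_k, (i <= j)%N -> w i <= w j) ->
  (forall i j, 0 <= p i j) ->
  (forall i : 'I_n, m i != 0 -> \sum_j p i j = 1) ->
  (forall j, \sum_i p i j <= 1) ->
  \sum_(i < minn n k) m (widen_ord (geq_minl n k) i) * w (widen_ord (geq_minr n k) i)
    <= \sum_i \sum_j m i * w j * p i j.
Proof.
move=> m_ge0 m_decr w_ge0 w_incr p_ge0 p_row p_col.
pose m' i := if insub i is Some j then m j else 0.
pose w' i := if insub i is Some j then w j else 0.
have m'E (i : 'I_n) : m' i = m i by rewrite /m' valK.
have w'E (i : 'I_k) : w' i = w i by rewrite /w' valK.
have m'_out (i : nat) : (n <= i)%N -> m' i = 0 by move=> ?; rewrite /m' insubF //; lia.
have := @substochastic_rearrangement_nat n k m' w' p.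
have -> : \sum_(0 <= i < minn n k) m' i * w' i =
  \sum_(i < minn n k) m (widen_ord (geq_minl n k) i) * w (widen_ord (geq_minr n k) i).
  by rewrite big_mkord; apply: eq_bigr => i _; rewrite -m'E -w'E.
have -> : \sum_(i < n) \sum_(j < k) m' i * w' j * p i j =
  \sum_i \sum_j m i * w j * p i j.
  by apply: eq_bigr => i _; apply: eq_bigr => j _; rewrite m'E w'E.
apply => //.
- by move=> i; rewrite /m'; case: insubP.
- move=> i j ij; case: (ltnP j n) => jn.
    have i_n := leq_ltn_trans ij jn.
    by rewrite (m'E (Ordinal i_n)) (m'E (Ordinal jn)) m_decr.
  by rewrite (m'_out _ jn) /m'; case: insubP.
- by move=> j jk; rewrite (w'E (Ordinal jk)).
- move=> i j /andP[ij jk]; have ik := leq_ltn_trans ij jk.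
  by rewrite (w'E (Ordinal ik)) (w'E (Ordinal jk)) w_incr.
- by move=> i; rewrite m'E; apply: p_row.
Qed.

Lemma doubly_stochastic_rearrangement n (m w : 'I_n -> R) (p : 'I_n -> 'I_n -> R) :
  (forall i, 0 <= m i) ->
  (forall i j : 'I_n, (i <= j)%N -> m j <= m i) ->
  (forall j, 0 <= w j) ->
  (forall i j : 'I_n, (i <= j)%N -> w i <= w j) ->
  (forall i j, 0 <= p i j) ->
  (forall i, \sum_j p i j = 1) -> (forall j, \sum_i p i j = 1) ->
  \sum_i m i * w i <= \sum_i \sum_j m i * w j * p i j.
Proof.
move=> m_ge0 m_decr w_ge0 w_incr p_ge0 p_row p_col.
apply: le_trans (@substochastic_rearrangement n n m w p _ _ _ _ _ _ _) => //.
  rewrite le_eqVlt; apply/orP; left; apply/eqP.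
  have : minn n n = n by rewrite minnn.
  move=> E; rewrite (reindex (cast_ord E)) /=; last first.
    by exists (cast_ord (esym E)) => i _; rewrite ?cast_ordK ?cast_ordKV.
  by apply: eq_bigr => i _; congr (m _ * w _); apply: val_inj.
by move=> j; rewrite p_col.
Qed.

End Rearrangement.

(** * Trace of the inverse of a sum *)

Section TraceInverse.
Context {R : realType}.

Definition nonincr {n} (f : 'I_n -> R) := forall i j : 'I_n, (i <= j)%N -> f j <= f i.
Definition nondecr {n} (f : 'I_n -> R) := forall i j : 'I_n, (i <= j)%N -> f i <= f j.

Definition doubly_stochastic {n} (S : 'I_n -> 'I_n -> R) :=
  [/\ forall i j, 0 <= S i j, forall i, \sum_j S i j = 1 & forall j, \sum_i S i j = 1].

(** The case of nondecreasing [m] follows from the other one by exchanging [m] and [w] and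
    transposing [S]. *)
Lemma opposite_rearrangement n (m w : 'I_n -> R) (S : 'I_n -> 'I_n -> R) :
  doubly_stochastic S -> (forall i, 0 <= m i) -> (forall i, 0 <= w i) ->
  (nonincr m /\ nondecr w) \/ (nondecr m /\ nonincr w) ->
  \sum_i m i * w i <= \sum_i m i * (\sum_j w j * S i j).
Proof.
move=> [S_ge0 S_row S_col] m_ge0 w_ge0.
have -> : \sum_i m i * (\sum_j w j * S i j) = \sum_i \sum_j m i * w j * S i j.
  by apply: eq_bigr => i _; rewrite mulr_sumr; apply: eq_bigr => j _; rewrite mulrA.
move=> [[m_decr w_incr]|[m_incr w_decr]]; first exact: doubly_stochastic_rearrangement.
rewrite exchange_big /=.
under eq_bigr do rewrite mulrC.
have := @doubly_stochastic_rearrangement _ n w m (fun i j => S j i).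
move=> /(_ w_ge0 w_decr m_ge0 m_incr (fun i j => S_ge0 j i) S_col S_row) /le_trans; apply.
by apply: ler_sum => i _; apply: ler_sum => j _; rewrite (mulrC (w i)).
Qed.

Lemma stochastic_mean_gt0 n (p : 'I_n -> R) (S : 'I_n -> R) :
  (forall i, 0 < p i) -> (forall i, 0 <= S i) -> \sum_i S i = 1 ->
  0 < \sum_i p i * S i.
Proof.
move=> p_gt0 S_ge0 S1.
have pS_ge0 i : 0 <= p i * S i by rewrite mulr_ge0 // ltW.
rewrite lt_neqAle sumr_ge0 ?andbT //; apply/eqP => /esym S0.
have : \sum_i S i = 0.
  apply: big1 => i _.
  have /eqP := @psumr_eq0P _ _ xpredT _ (fun i _ => pS_ge0 i) S0 i isT.
  by rewrite mulf_eq0 gt_eqF //= => /eqP.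
by rewrite S1 => /eqP; rewrite oner_eq0.
Qed.

(* Since [1 / x >= 2 t - t ^ 2 * x], it suffices to bound
   [\sum_i (p i + q i) / g i ^ 2] by [\sum_i g i / g i ^ 2]. *)
Lemma sum_inv_mean_le n (p q g : 'I_n -> R) (S T : 'I_n -> 'I_n -> R) :
  doubly_stochastic S -> doubly_stochastic T ->
  (forall i, 0 < p i) -> (forall i, 0 < q i) ->
  (forall i, g i = \sum_j p j * S i j + \sum_j q j * T i j) ->
  [/\ nonincr p, nonincr q & nonincr g] \/ [/\ nondecr p, nondecr q & nondecr g] ->
  \sum_i (g i)^-1 <= \sum_i (p i + q i)^-1.
Proof.
move=> SS TT p_gt0 q_gt0 gE mono.
have g_gt0 i : 0 < g i.
  rewrite gE addr_gt0 //; apply: stochastic_mean_gt0 => //.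
  - by case: SS => + _ _; exact.
  - by case: SS => _ + _; exact.
  - by case: TT => + _ _; exact.
  - by case: TT => _ + _; exact.
pose h i := (g i)^-1 ^+ 2.
have h_ge0 i : 0 <= h i by rewrite sqr_ge0.
have h_mono i j : g i <= g j -> h j <= h i.
  move=> gij; rewrite /h ler_pXn2r ?nnegrE ?invr_ge0 ?(ltW (g_gt0 _)) //.
  by rewrite lef_pV2 ?posrE.
have le_h (r : 'I_n -> R) : (forall i, 0 < r i) ->
    (nonincr r /\ nonincr g) \/ (nondecr r /\ nondecr g) ->
    forall S', doubly_stochastic S' ->
    \sum_i h i * r i <= \sum_i h i * (\sum_j r j * S' i j).
  move=> r_gt0 rg S' SS'; apply: opposite_rearrangement => //.
    by move=> i; exact/ltW.
  by case: rg => [[rd gd]|[ri gi]]; [right|left]; split => // i j ij; apply: h_mono;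
    [exact: gd|exact: gi].
have le_p := le_h p p_gt0 _ S SS.
have le_q := le_h q q_gt0 _ T TT.
have hpq : \sum_i h i * (p i + q i) <= \sum_i (g i)^-1.
  have -> : \sum_i (g i)^-1 = \sum_i h i * g i.
    by apply: eq_bigr => i _; rewrite /h expr2 -mulrA mulVf ?mulr1 // gt_eqF.
  have -> : \sum_i h i * g i =
      \sum_i h i * (\sum_j p j * S i j) + \sum_i h i * (\sum_j q j * T i j).
    by rewrite -big_split; apply: eq_bigr => i _; rewrite gE mulrDr.
  under eq_bigr do rewrite mulrDr.
  rewrite big_split lerD //.
    by apply: le_p; case: mono => -[? ? ?]; [left|right].
  by apply: le_q; case: mono => -[? ? ?]; [left|right].
have tangent i : 2 * (g i)^-1 - h i * (p i + q i) <= (p i + q i)^-1.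
  have pq_gt0 : 0 < p i + q i by rewrite addr_gt0.
  rewrite -(ler_pM2r pq_gt0) mulVf ?gt_eqF // -subr_ge0 /h.
  have -> : 1 - (2 * (g i)^-1 - (g i)^-1 ^+ 2 * (p i + q i)) * (p i + q i) =
    (1 - (g i)^-1 * (p i + q i)) ^+ 2 by ring.
  exact: sqr_ge0.
have : \sum_i (2 * (g i)^-1 - h i * (p i + q i)) <= \sum_i (p i + q i)^-1.
  by apply: ler_sum => i _; exact: tangent.
by rewrite sumrB -mulr_sumr; lra.
Qed.

(** Columns of an isometry have norm one; so do its rows, since a square isometry is unitary. *)
Lemma unistochastic n (W : 'M[R[i]]_n) : ctmx W *m W = 1%:M ->
  doubly_stochastic (fun i j => sqnorm (W j i)).
Proof.
move=> WW; split => [i j|i|j]; first exact: sqnorm_ge0.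
  have := gramE W i; rewrite WW mxE eqxx => /(congr1 (@complex.Re _)) /=.
  by move=> <-.
have := gramE (ctmx W) j; rewrite ctmxK isometryC // mxE eqxx.
move=> /(congr1 (@complex.Re _)) /= ->.
by apply: eq_bigr => i _; rewrite ctmxE sqnormJ.
Qed.

(** Inverting a positive nonincreasing spectrum makes it nondecreasing, hence the need for this
    second ordering, obtained from [- A]. *)
Lemma spectral_nondecr n (A : 'M[R[i]]_n) : ctmx A = A ->
  exists (W : 'M[R[i]]_n) (d : 'I_n -> R),
    [/\ ctmx W *m W = 1%:M, A = W *m rdiag d *m ctmx W & nondecr d].
Proof.
move=> AA; have [|W [d [WW AD dd]]] := @spectral_sorted _ _ (- A).
  by rewrite ctmxN AA.
exists W, (fun i => - d i); split => // [|i j ij]; last by rewrite lerN2 dd.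
by rewrite rdiagN mulmxN mulNmx -AD opprK.
Qed.

Lemma ctmx_conj m n (W : 'M[R[i]]_(m, n)) (A : 'M[R[i]]_n) : ctmx A = A ->
  ctmx (W *m A *m ctmx W) = W *m A *m ctmx W.
Proof. by move=> AA; rewrite !ctmxM ctmxK AA mulmxA. Qed.

Lemma retr_conj n (W A : 'M[R[i]]_n) : ctmx W *m W = 1%:M ->
  retr (W *m A *m ctmx W) = retr A.
Proof. by move=> WW; rewrite retrC mulmxA WW mul1mx. Qed.

(** In an eigenbasis of [G], sorted the same way as [p] and [q], each eigenvalue is a diagonal
    entry, hence an average of [p] plus an average of [q] with doubly stochastic weights. *)
Lemma retr_invmxD_le n (U V : 'M[R[i]]_n) (p q : 'I_n -> R) :
  ctmx U *m U = 1%:M -> ctmx V *m V = 1%:M ->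
  (forall i, 0 < p i) -> (forall i, 0 < q i) ->
  (nonincr p /\ nonincr q) \/ (nondecr p /\ nondecr q) ->
  let G := U *m rdiag p *m ctmx U + V *m rdiag q *m ctmx V in
  G \in unitmx /\ retr (invmx G) <= \sum_i (p i + q i)^-1.
Proof.
move=> UU VV p_gt0 q_gt0 pq_mono G.
have GG : ctmx G = G by rewrite ctmxD !ctmx_conj ?ctmx_rdiag.
have [W [g [WW GE mono]]] : exists (W : 'M[R[i]]_n) (g : 'I_n -> R),
    [/\ ctmx W *m W = 1%:M, G = W *m rdiag g *m ctmx W
      & [/\ nonincr p, nonincr q & nonincr g] \/
        [/\ nondecr p, nondecr q & nondecr g]].
  case: pq_mono => -[pm qm].
    by have [W [g [? ? ?]]] := spectral_sorted GG; exists W, g; split => //; left.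
  by have [W [g [? ? ?]]] := spectral_nondecr GG; exists W, g; split => //; right.
have isoM (Z : 'M[R[i]]_n) : ctmx Z *m Z = 1%:M ->
    ctmx (ctmx Z *m W) *m (ctmx Z *m W) = 1%:M.
  move=> ZZ; rewrite ctmxM ctmxK mulmxA -(mulmxA _ Z) isometryC // mulmx1.
  exact: WW.
have gE i : g i = \sum_j p j * sqnorm ((ctmx U *m W) j i)
                + \sum_j q j * sqnorm ((ctmx V *m W) j i).
  have : (ctmx W *m G *m W) i i = (g i)%:C.
    by rewrite GE !mulmxA WW mul1mx -mulmxA WW mulmx1 rdiagE eqxx.
  rewrite mulmxDr mulmxDl mxE.
  have conjE (Z : 'M[R[i]]_n) (d : 'I_n -> R) :
      ctmx W *m (Z *m rdiag d *m ctmx Z) *m W =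
      ctmx (ctmx Z *m W) *m rdiag d *m (ctmx Z *m W).
    by rewrite ctmxM ctmxK !mulmxA.
  by rewrite !conjE !congr_rdiagE -rmorphD => /complexI ->.
have SU := unistochastic (isoM _ UU); have SV := unistochastic (isoM _ VV).
have g_gt0 i : 0 < g i.
  by rewrite gE addr_gt0 //; apply: stochastic_mean_gt0 => //;
    [case: SU|case: SU|case: SV|case: SV].
have GV := invmx_spectral WW (fun i => lt0r_neq0 (g_gt0 i)).
rewrite -GE in GV.
split; first by case: (mulmx1_unit GV).
rewrite (invmx_eq GV) retr_conj // retr_rdiag.
exact: (sum_inv_mean_le SU SV).
Qed.

(** Converts a bound on the inverse of [P^-1 + Q^-1] into one on [P (P + Q)^-1 P]. *)
Lemma parallel_sum n (P Q : 'M[R[i]]_n) :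
  P \in unitmx -> Q \in unitmx -> P + Q \in unitmx ->
  invmx (invmx P + invmx Q) = P - P *m invmx (P + Q) *m P.
Proof.
move=> Pu Qu PQu.
suff: (P - P *m invmx (P + Q) *m P) *m (invmx P + invmx Q) = 1%:M.
  by move=> /mulmx1C; exact: invmx_eq.
rewrite mulmxDr !mulmxBl (mulmxV Pu) -(mulmxA _ P (invmx P)) mulmxV // mulmx1.
have -> : P *m invmx Q = P *m invmx (P + Q) *m (P + Q) *m invmx Q.
  by rewrite -(mulmxA P) mulVmx // mulmx1.
rewrite mulmxDr mulmxDl -(mulmxA _ Q) mulmxV // mulmx1.
by rewrite [X in _ + (X - _)]addrC addrK subrK.
Qed.

(** The bound on the trace of an inverse is applied to [P^-1] and [Q^-1], whose spectra are both
    nondecreasing; the scalar case is [1 / (1/p + 1/q) = p - p^2 / (p + q)]. *)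
Lemma retr_parallel_ge n (V : 'M[R[i]]_n) (p q : 'I_n -> R) :
  ctmx V *m V = 1%:M -> (forall i, 0 < p i) -> (forall i, 0 < q i) ->
  nonincr p -> nonincr q ->
  \sum_i p i ^+ 2 / (p i + q i) <=
    retr (rdiag p *m invmx (rdiag p + V *m rdiag q *m ctmx V) *m rdiag p).
Proof.
move=> VV p_gt0 q_gt0 p_mono q_mono.
set P := rdiag p; set Q := V *m rdiag q *m ctmx V.
have U1 : ctmx (1%:M : 'M[R[i]]_n) *m 1%:M = 1%:M by rewrite mulmx1 ctmx1.
have P1 (d : 'I_n -> R) : 1%:M *m rdiag d *m ctmx 1%:M = rdiag d.
  by rewrite ctmx1 mulmx1 mul1mx.
have [PQu _] := retr_invmxD_le U1 VV p_gt0 q_gt0 (or_introl (conj p_mono q_mono)).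
rewrite P1 -/P -/Q in PQu.
have pV : P *m rdiag (fun i => (p i)^-1) = 1%:M by apply: rdiagV => i; rewrite gt_eqF.
have qV := invmx_spectral VV (fun i => lt0r_neq0 (q_gt0 i)).
have inv_mono (d : 'I_n -> R) : (forall i, 0 < d i) -> nonincr d ->
    nondecr (fun i => (d i)^-1).
  by move=> d_gt0 dd i j ij; rewrite lef_pV2 ?posrE // dd.
have pV_gt0 i : 0 < (p i)^-1 by rewrite invr_gt0.
have qV_gt0 i : 0 < (q i)^-1 by rewrite invr_gt0.
have [Pu _] := mulmx1_unit pV; have [Qu _] := mulmx1_unit qV.
have [_] := retr_invmxD_le U1 VV pV_gt0 qV_gt0
  (or_intror (conj (inv_mono _ p_gt0 p_mono) (inv_mono _ q_gt0 q_mono))).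
rewrite P1 -(invmx_eq pV) -(invmx_eq qV) parallel_sum // retrD retrN retr_rdiag.
rewrite lerBlDr -lerBlDl; apply: le_trans.
rewrite -sumrB le_eqVlt; apply/orP; left; apply/eqP; apply: eq_bigr => i _.
have [? ?] := (p_gt0 i, q_gt0 i).
by field; rewrite ?gt_eqF ?addr_gt0.
Qed.

End TraceInverse.

(** * Gain and power of a relay matrix *)

Section Relay.
Context {R : realType}.

(* The shift by [1/2] completes the square in [g ^ 2 - g] and keeps both
   summands positive definite. *)
Lemma retr_weighted_inv_ge n (V : 'M[R[i]]_n) (g m : 'I_n -> R) :
  ctmx V *m V = 1%:M -> (forall i, 1 <= g i) -> (forall i, 0 <= m i) ->
  nonincr g -> nonincr m ->
  \sum_i (g i ^+ 2 - g i) / (g i + m i) <=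
    retr (rdiag (fun i => g i ^+ 2 - g i) *m
          invmx (rdiag g + V *m rdiag m *m ctmx V)).
Proof.
move=> VV g_ge1 m_ge0 g_mono m_mono.
pose p i := g i - 2^-1; pose q i := m i + 2^-1.
have p_gt0 i : 0 < p i by have := g_ge1 i; rewrite /p; lra.
have q_gt0 i : 0 < q i by have := m_ge0 i; rewrite /q; lra.
have p_mono : nonincr p by move=> i j ij; rewrite /p lerD2r g_mono.
have q_mono : nonincr q by move=> i j ij; rewrite /q lerD2r m_mono.
have U1 : ctmx (1%:M : 'M[R[i]]_n) *m 1%:M = 1%:M by rewrite mulmx1 ctmx1.
have [_] := retr_invmxD_le U1 VV p_gt0 q_gt0 (or_introl (conj p_mono q_mono)).
rewrite ctmx1 mulmx1 mul1mx.
have := retr_parallel_ge VV p_gt0 q_gt0 p_mono q_mono.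
have <- : rdiag g + V *m rdiag m *m ctmx V = rdiag p + V *m rdiag q *m ctmx V.
  have -> : rdiag q = rdiag m + (2^-1)%:C%:M.
    by rewrite -rdiag_const rdiagD.
  rewrite mulmxDr mulmxDl mul_mx_scalar -scalemxAl isometryC // scalemx1.
  rewrite [X in _ = _ + X]addrC addrA; congr (_ + _).
  by rewrite -rdiag_const rdiagD; apply: eq_rdiag => i; rewrite /p subrK.
set G := rdiag g + _.
(* As [g^2 - g = p^2 - 1/4], the trace splits in two: the first part has a lower bound, the second
   an upper bound and a minus sign. *)
have -> : rdiag (fun i => g i ^+ 2 - g i) *m invmx G =
   rdiag p *m (rdiag p *m invmx G) - (4^-1)%:C *: invmx G.
  rewrite mulmxA rdiagM -mul_scalar_mx -mulmxBl -rdiag_const -rdiagN rdiagD.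
  by congr (_ *m _); apply: eq_rdiag => i; rewrite /p; field.
rewrite retrD retrN retrZ retrC => par inv.
have -> : \sum_i (g i ^+ 2 - g i) / (g i + m i) =
    \sum_i p i ^+ 2 / (p i + q i) - 4^-1 * \sum_i (p i + q i)^-1.
  rewrite mulr_sumr -sumrB; apply: eq_bigr => i _.
  have pqE : p i + q i = g i + m i by rewrite /p /q addrACA addNr addr0.
  rewrite pqE /p; have [? ?] := (g_ge1 i, m_ge0 i).
  by field; rewrite gt_eqF //; lra.
lra.
Qed.

(** The eigenvalues are nonnegative because [d i] is the squared norm of column [i] of [Z W]. *)
Lemma gram_spectral m n (Z : 'M[R[i]]_(m, n)) :
  exists (W : 'M[R[i]]_n) (d : 'I_n -> R),
    [/\ ctmx W *m W = 1%:M, ctmx Z *m Z = W *m rdiag d *m ctmx W,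
        nonincr d & forall i, 0 <= d i].
Proof.
have [|W [d [WW ZE dd]]] := @spectral_sorted _ _ (ctmx Z *m Z).
  by rewrite ctmxM ctmxK.
exists W, d; split => // i.
have : (ctmx (Z *m W) *m (Z *m W)) i i = (d i)%:C.
  rewrite ctmxM !mulmxA -(mulmxA (ctmx W)) ZE !mulmxA WW mul1mx -mulmxA WW.
  by rewrite mulmx1 rdiagE eqxx.
rewrite gramE => /complexI <-; apply: sumr_ge0 => k _; exact: sqnorm_ge0.
Qed.

Lemma gram1_spectral m n (Z : 'M[R[i]]_(m, n)) :
  exists (W : 'M[R[i]]_n) (d : 'I_n -> R),
    [/\ ctmx W *m W = 1%:M, forall i, 0 < d i
      & 1%:M + ctmx Z *m Z = W *m rdiag d *m ctmx W].
Proof.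
have [W [d [WW ZE _ d_ge0]]] := gram_spectral Z.
exists W, (fun i => 1 + d i); split => // [i|]; first by have := d_ge0 i; lra.
by rewrite -rdiagD rdiag1 mulmxDr mulmxDl mulmx1 isometryC // ZE.
Qed.

Lemma gram1_unit m n (Z : 'M[R[i]]_(m, n)) : 1%:M + ctmx Z *m Z \in unitmx.
Proof.
have [W [d [WW d_gt0 ->]]] := gram1_spectral Z.
by have [] := mulmx1_unit (invmx_spectral WW (fun i => lt0r_neq0 (d_gt0 i))).
Qed.

Lemma gramC1_unit m n (Z : 'M[R[i]]_(m, n)) : 1%:M + Z *m ctmx Z \in unitmx.
Proof. by have := gram1_unit (ctmx Z); rewrite ctmxK. Qed.

(** Moving [Z^H] across the inverse replaces [Z Z^H] by [Z^H Z], which has the size of [H1 H1^H]. *)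
Lemma push_through m n (Z : 'M[R[i]]_(m, n)) :
  ctmx Z *m invmx (1%:M + Z *m ctmx Z) *m Z = 1%:M - invmx (1%:M + ctmx Z *m Z).
Proof.
have pass : ctmx Z *m invmx (1%:M + Z *m ctmx Z) =
    invmx (1%:M + ctmx Z *m Z) *m ctmx Z.
  apply: (canLR (mulmxK (gramC1_unit Z))); rewrite -mulmxA.
  apply: (canRL (mulKmx (gram1_unit Z))).
  by rewrite mulmxDl mulmxDr mul1mx mulmx1 mulmxA.
rewrite pass -mulmxA; apply: (canLR (mulKmx (gram1_unit Z))).
by rewrite mulmxBr mulmxV ?gram1_unit // mulmx1 addrC addrA addNr add0r.
Qed.

(** The part of the trace in the capacity that depends on the relay, with [Z] standing for
    [H2 X]. *)
Definition gain t s r (H1 : 'M[R[i]]_(s, t)) (Z : 'M[R[i]]_(r, s)) : R :=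
  retr (ctmx (Z *m H1) *m invmx (1%:M + Z *m ctmx Z) *m (Z *m H1)).

(** Keeps the argument of the logarithm positive. In an eigenbasis of [1 + Z Z^H] the gain is a sum
    of squared moduli with positive weights. *)
Lemma gain_ge0 t s r (H1 : 'M[R[i]]_(s, t)) (Z : 'M[R[i]]_(r, s)) : 0 <= gain H1 Z.
Proof.
have [W [d [WW d_gt0 E]]] := gram1_spectral (ctmx Z); rewrite ctmxK in E.
rewrite /gain E (invmx_eq (invmx_spectral WW (fun i => lt0r_neq0 (d_gt0 i)))).
set T := Z *m H1.
have -> : ctmx T *m (W *m rdiag (fun i => (d i)^-1) *m ctmx W) *m T =
   ctmx (ctmx W *m T) *m rdiag (fun i => (d i)^-1) *m (ctmx W *m T).
  by rewrite ctmxM ctmxK !mulmxA.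
rewrite retrE; apply: sumr_ge0 => i _; rewrite congr_rdiagE /=.
by apply: sumr_ge0 => k _; rewrite mulr_ge0 ?sqnorm_ge0 ?invr_ge0 ?ltW.
Qed.

(** After the push-through identity the gain is [tr A - tr ((1 + Z^H Z)^-1 A)] with [A = H1 H1^H].
    Conjugating by [U] and rescaling by the square root of [g] turns [1 + Z^H Z] into
    [rdiag g + T^H T]. *)
Lemma gainE t s r (H1 : 'M[R[i]]_(s, t)) (Z : 'M[R[i]]_(r, s)) (U : 'M[R[i]]_s)
    (al g : 'I_s -> R) :
  ctmx U *m U = 1%:M -> H1 *m ctmx H1 = U *m rdiag al *m ctmx U ->
  (forall i, 0 < g i) ->
  let T := Z *m U *m rdiag (fun i => Num.sqrt (g i)) in
  gain H1 Z = \sum_i al i -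
    retr (rdiag (fun i => al i * g i) *m invmx (rdiag g + ctmx T *m T)).
Proof.
move=> UU HE g_gt0 /=; set D := rdiag (fun i => Num.sqrt _); set T := _ *m D.
have DV : D *m rdiag (fun i => (Num.sqrt (g i))^-1) = 1%:M.
  by apply: rdiagV => i; rewrite gt_eqF // sqrtr_gt0.
have DD : D *m D = rdiag g.
  by rewrite rdiagM; apply: eq_rdiag => i; rewrite -expr2 sqr_sqrtr // ltW.
set G := rdiag g + _.
have GE : G = D *m ctmx U *m (1%:M + ctmx Z *m Z) *m (U *m D).
  rewrite mulmxDr mulmxDl mulmx1 mulmxA -(mulmxA D) UU mulmx1 DD; congr (_ + _).
  by rewrite !ctmxM ctmx_rdiag !mulmxA.
have [Du _] := mulmx1_unit DV; have [U'u Uu] := mulmx1_unit UU.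
have Gu : G \in unitmx.
  by rewrite GE !unitmx_mul Du Uu U'u gram1_unit.
have inv : invmx (1%:M + ctmx Z *m Z) = U *m D *m invmx G *m (D *m ctmx U).
  apply: invmx_eq; rewrite !mulmxA -mulmxA; apply: mulmx1C.
  by apply: etrans (mulmxV Gu); rewrite {2}GE !mulmxA.
have -> : gain H1 Z =
    retr (ctmx Z *m invmx (1%:M + Z *m ctmx Z) *m Z *m (H1 *m ctmx H1)).
  by rewrite [in RHS]mulmxA [RHS]retrC /gain ctmxM !mulmxA.
rewrite push_through mulmxBl mul1mx retrD retrN HE retr_conj // retr_rdiag inv.
congr (_ - _).
have -> : U *m D *m invmx G *m (D *m ctmx U) *m (U *m rdiag al *m ctmx U) =
    U *m (D *m invmx G *m (D *m rdiag al)) *m ctmx U.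
  by rewrite !mulmxA -(mulmxA _ (ctmx U) U) UU mulmx1.
rewrite retr_conj // retrC mulmxA !rdiagM; congr (retr (_ *m _)).
apply: eq_rdiag => i.
by rewrite mulrC mulrA -expr2 sqr_sqrtr ?ltW // mulrC.
Qed.

(** The row space of [W^H] lies in that of [B] and has the same dimension, so [B = L W^H] for some
    [L]; multiplying by [W] identifies [L] with [B W]. *)
Lemma rank_spectral n k (B : 'M[R[i]]_n) (W : 'M[R[i]]_(n, k)) (mu : 'I_k -> R) :
  \rank B = k -> ctmx B = B -> ctmx W *m W = 1%:M -> (forall i, mu i != 0) ->
  B *m W = W *m rdiag mu -> B = W *m rdiag mu *m ctmx W.
Proof.
move=> rkB BB WW muN0 BW.
have WB : ctmx W *m B = rdiag mu *m ctmx W.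
  by rewrite -{1}BB -ctmxM BW ctmxM ctmx_rdiag.
have sub : (ctmx W <= B)%MS.
  apply/submxP; exists (rdiag (fun i => (mu i)^-1) *m ctmx W).
  rewrite -mulmxA WB mulmxA -[LHS]mul1mx; congr (_ *m _).
  by apply/esym/mulmx1C/rdiagV.
have rk : \rank (ctmx W) = \rank B.
  apply/eqP; rewrite eqn_leq mxrankS //= rkB -[leqLHS](mxrank1 R[i]) -WW.
  exact: mxrankM_maxl.
have /submxP [L BL] : (B <= ctmx W)%MS by rewrite -(geq_leqif (mxrank_leqif_sup sub)) rk.
have -> : W *m rdiag mu = L.
  by rewrite -BW BL -mulmxA WW mulmx1.
exact: BL.
Qed.

(** [L = Q Q^H] is an orthogonal projection, so its diagonal entry [S] satisfies [S = S^2] plus a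
    nonnegative rest, which forces [S <= 1]. *)
Lemma contraction_col n k (Q : 'M[R[i]]_(k, n)) (e : 'I_n -> R) :
  ctmx Q *m Q = rdiag e -> Q *m rdiag e = Q ->
  forall j, \sum_i sqnorm (Q j i) <= 1.
Proof.
move=> QQ Qe j; set S := \sum_i _.
pose L := Q *m ctmx Q.
have LS : L j j = S%:C.
  have := gramE (ctmx Q) j; rewrite ctmxK => ->; congr (_%:C).
  by apply: eq_bigr => i _; rewrite ctmxE sqnormJ.
have LL : ctmx L *m L = L.
  by rewrite /L ctmxM ctmxK mulmxA -(mulmxA Q) QQ Qe.
have : S = \sum_i sqnorm (L i j).
  by apply: complexI; rewrite -LS -{1}LL gramE.
rewrite (bigD1 j) //= LS sqnorm_real => SE.
have : S ^+ 2 <= S.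
  by rewrite {2}SE lerDl; apply: sumr_ge0 => i _; exact: sqnorm_ge0.
have S_ge0 : 0 <= S by apply: sumr_ge0 => i _; exact: sqnorm_ge0.
by move=> ?; nra.
Qed.

(** The normalised matrix [Q] is a partial isometry, so its squared moduli are substochastic
    weights, and the rearrangement inequality applies to [d] and [1 / mu]. *)
Lemma power_lower_bound n k u (W : 'M[R[i]]_(u, k)) (mu : 'I_k -> R)
    (Y : 'M[R[i]]_(u, n)) (V : 'M[R[i]]_n) (d : 'I_n -> R) :
  ctmx W *m W = 1%:M -> (forall j, 0 < mu j) -> nonincr mu ->
  ctmx V *m V = 1%:M -> (forall i, 0 <= d i) -> nonincr d ->
  ctmx Y *m (W *m rdiag mu *m ctmx W) *m Y = V *m rdiag d *m ctmx V ->
  (forall i : 'I_n, (k <= i)%N -> d i = 0) /\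
  \sum_(i < minn n k) d (widen_ord (geq_minl n k) i) / mu (widen_ord (geq_minr n k) i)
    <= retr (ctmx Y *m Y).
Proof.
move=> WW mu_gt0 mu_mono VV d_ge0 d_mono YE.
pose N := ctmx W *m Y *m V.
have NN : ctmx N *m rdiag mu *m N = rdiag d.
  have -> : ctmx N *m rdiag mu *m N =
      ctmx V *m (ctmx Y *m (W *m rdiag mu *m ctmx W) *m Y) *m V.
    by rewrite /N !ctmxM ctmxK !mulmxA.
  by rewrite YE !mulmxA VV mul1mx -mulmxA VV mulmx1.
(* Where [d i = 0] the inverse is 0 by convention, so column [i] of [Q] vanishes; [e] marks the
   other columns. *)
pose Q := rdiag (fun j => Num.sqrt (mu j)) *m N *m rdiag (fun i => (Num.sqrt (d i))^-1).
pose e (i : 'I_n) : R := (d i != 0)%:R.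
have QQ : ctmx Q *m Q = rdiag e.
  have -> : ctmx Q *m Q = rdiag (fun i => (Num.sqrt (d i))^-1) *m
      (ctmx N *m (rdiag (fun j => Num.sqrt (mu j)) *m rdiag (fun j => Num.sqrt (mu j))) *m N)
      *m rdiag (fun i => (Num.sqrt (d i))^-1).
    by rewrite /Q !ctmxM !ctmx_rdiag !mulmxA.
  have -> : rdiag (fun j => Num.sqrt (mu j)) *m rdiag (fun j => Num.sqrt (mu j)) = rdiag mu.
    by rewrite rdiagM; apply: eq_rdiag => j; rewrite -expr2 sqr_sqrtr // ltW.
  rewrite NN !rdiagM; apply: eq_rdiag => i; rewrite /e.
  have [->|di] := eqVneq (d i) 0; first by rewrite mulr0 mul0r.
  rewrite mulrAC -invfM -expr2 sqr_sqrtr ?d_ge0 // mulVf //.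
have Qe : Q *m rdiag e = Q.
  rewrite /Q -mulmxA rdiagM; congr (_ *m _); apply: eq_rdiag => i; rewrite /e.
  by have [->|di] := eqVneq (d i) 0; rewrite ?sqrtr0 ?invr0 ?mul0r ?mulr1.
have QE i j : sqnorm (Q j i) = mu j * sqnorm (N j i) * (d i)^-1.
  rewrite /Q rdiag_scaleE !sqnormM.
  by rewrite !sqnorm_real exprVn !sqr_sqrtr ?d_ge0 // ltW.
have p_row i : \sum_j sqnorm (Q j i) = e i.
  by apply: complexI; rewrite -gramE QQ rdiagE eqxx.
have p_col := contraction_col QQ Qe.
split.
  (* If [d i] were nonzero, so would be all earlier [d l], giving more than [k] nonzero columns; but
     the squared moduli of [Q] sum to at most [k], one per row. *)
  move=> i ki; apply/eqP/negPn/negP => di.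
  have : \sum_i e i <= k%:R.
    under eq_bigr do rewrite -p_row.
    rewrite exchange_big /= -[k in k%:R]card_ord -sumr_const.
    by apply: ler_sum => j _; exact: p_col.
  apply/negP; rewrite -ltNge.
  have iS : \sum_(l < n | (l < i.+1)%N) (1 : R) <= \sum_l e l.
    rewrite [leRHS](bigID (fun l : 'I_n => (l < i.+1)%N)) /=.
    rewrite -[leLHS]addr0 lerD //; last by apply: sumr_ge0 => l _; rewrite /e.
    apply: ler_sum => l li; rewrite /e gt_eqF //.
    by apply: lt_le_trans (d_mono _ _ li); rewrite lt_neqAle eq_sym di d_ge0.
  apply: lt_le_trans iS; rewrite sumr_const ltr_nat.
  have -> : #|(fun l : 'I_n => (l < i.+1)%N)| = i.+1.
    by rewrite -sum1_card (big_ord_narrow (ltn_ord i)) /= sum1_card card_ord.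
  by rewrite ltnS.
have wmono : nondecr (fun j => (mu j)^-1).
  by move=> i j ij; rewrite lef_pV2 ?posrE // mu_mono.
apply: le_trans (@substochastic_rearrangement _ n k d (fun j => (mu j)^-1)
  (fun i j => sqnorm (Q j i)) d_ge0 d_mono _ wmono _ _ _) _ => //.
- by move=> j; rewrite invr_ge0 ltW.
- by move=> i j; exact: sqnorm_ge0.
- by move=> i di; rewrite p_row /e di.
apply: (@le_trans _ _ (retr (ctmx N *m N))).
  rewrite retr_gram; apply: ler_sum => i _; apply: ler_sum => j _.
  rewrite QE; have [->|di] := eqVneq (d i) 0; first by rewrite !mul0r sqnorm_ge0.
  by rewrite le_eqVlt; apply/orP; left; apply/eqP; field; rewrite di gt_eqF.
(* [Pi] projects onto the complement of the range of [W]; the part [Pi Y] only adds power. *)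
pose Pi := 1%:M - W *m ctmx W.
have PP : ctmx Pi *m Pi = Pi.
  have -> : ctmx Pi = Pi by rewrite /Pi ctmxD ctmxN ctmx1 ctmxM ctmxK.
  rewrite {2}/Pi mulmxBr mulmx1 /Pi mulmxBl mul1mx mulmxA -(mulmxA W) WW mulmx1.
  by rewrite subrr subr0.
have := retr_gram_ge0 (Pi *m Y).
have -> : ctmx (Pi *m Y) *m (Pi *m Y) = ctmx Y *m (ctmx Pi *m Pi) *m Y.
  by rewrite ctmxM !mulmxA.
rewrite PP /Pi mulmxBr mulmx1 mulmxBl retrD retrN subr_ge0; apply: le_trans.
have -> : ctmx N *m N = ctmx V *m (ctmx Y *m (W *m ctmx W) *m Y) *m V.
  by rewrite /N !ctmxM ctmxK !mulmxA.
by rewrite retrC mulmxA isometryC // mul1mx.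
Qed.

End Relay.

(** * Matrices of selected eigenvectors; capacity and power in terms of the gain *)

Section Selection.
Context {R : realType}.

Definition colsmx n k (f : 'I_k -> 'cV[R[i]]_n) : 'M[R[i]]_(n, k) :=
  \matrix_(i, j) f j i 0.

Lemma colsmx_gram n k l (f : 'I_k -> 'cV[R[i]]_n) (h : 'I_l -> 'cV[R[i]]_n) i j :
  (ctmx (colsmx f) *m colsmx h) i j = (ctmx (f i) *m h j) 0 0.
Proof. by rewrite !mxE; apply: eq_bigr => m _; rewrite !ctmxE !mxE. Qed.

Lemma colsmx_orth n k (f : 'I_k -> 'cV[R[i]]_n) :
  (forall i j, ctmx (f i) *m f j = (i == j)%:R%:M) ->
  ctmx (colsmx f) *m colsmx f = 1%:M.
Proof.
by move=> ff; apply/matrixP => i j; rewrite colsmx_gram ff !mxE mulr1n.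
Qed.

Lemma colsmx_eig n k (A : 'M[R[i]]_n) (f : 'I_k -> 'cV[R[i]]_n) (d : 'I_k -> R) :
  (forall i, A *m f i = (d i)%:C *: f i) ->
  A *m colsmx f = colsmx f *m rdiag d.
Proof.
move=> Af; apply/matrixP => i j.
rewrite mul_mx_diag [RHS]mxE mxE (_ : \sum_k0 _ = (A *m f j) i 0).
  by rewrite Af !mxE mulrC.
by rewrite mxE; apply: eq_bigr => l _; rewrite mxE.
Qed.

Lemma colsmx_sum n m k (f : 'I_k -> 'cV[R[i]]_n) (h : 'I_k -> 'cV[R[i]]_m)
    (d : 'I_k -> R) :
  \sum_i (d i)%:C *: (f i *m ctmx (h i)) = colsmx f *m rdiag d *m ctmx (colsmx h).
Proof.
apply/matrixP => i j; rewrite mulmx_rdiagE summxE; apply: eq_bigr => l _.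
by rewrite mxE [X in _ * X = _]mxE big_ord1 !ctmxE !mxE.
Qed.

(** Congruence by a 0/1 matrix with a single 1 in each row moves [h i] to position [f i] and puts
    zero at positions that are not hit. *)
Lemma congr_selection n k (K : 'M[R[i]]_(k, n)) (f : 'I_k -> 'I_n) (h : 'I_k -> R) :
  (forall i j, K i j = (f i == j)%:R) ->
  ctmx K *m rdiag h *m K = rdiag (fun j => \sum_i h i *+ (f i == j)).
Proof.
move=> KE; apply/matrixP => j l; rewrite mulmx_rdiagE rdiagE -sumrMnl rmorph_sum.
apply: eq_bigr => i _ /=; rewrite ctmxE !KE -mulrnA mulnb.
have [<-|fj] := eqVneq (f i) j; last by rewrite conjc0 mul0r mulr0.
by rewrite conjc1 mul1r mulr_natr -rmorphMn.
Qed.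

Lemma sum_selection n k (f : 'I_k -> 'I_n) (h : 'I_k -> R) i0 : injective f ->
  \sum_i h i *+ (f i == f i0) = h i0.
Proof.
move=> f_inj; rewrite (bigD1 i0) //= eqxx mulr1n big1 ?addr0 // => i ii0.
by rewrite (inj_eq f_inj) (negbTE ii0).
Qed.

Lemma sum_widen n k (kn : (k <= n)%N) (F : 'I_n -> R) :
  \sum_i F i = \sum_(i < k) F (widen_ord kn i) + \sum_(i < n | ~~ (i < k)%N) F i.
Proof. by rewrite (bigID (fun i : 'I_n => (i < k)%N)) /= big_ord_narrow. Qed.

Lemma C_OSTBC_gain t s u r (P1 Rate : R) (H0 : 'M[R[i]]_(r, t))
    (H1 : 'M[R[i]]_(s, t)) (H2 : 'M[R[i]]_(r, u)) (X : 'M[R[i]]_(u, s)) :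
  C_OSTBC P1 Rate H0 H1 H2 X =
  Rate * log2 (1 + P1 / (t%:R * Rate) *
                 (retr (ctmx H0 *m H0) + gain H1 (H2 *m X))).
Proof.
by rewrite /C_OSTBC -/(retr _) retrD /gain !ctmxM !mulmxA.
Qed.

(** The gain does not involve [Rate], so one comparison of gains settles every symbol rate. *)
Lemma C_OSTBC_le t s u r (P1 Rate : R) (H0 : 'M[R[i]]_(r, t))
    (H1 : 'M[R[i]]_(s, t)) (H2 : 'M[R[i]]_(r, u)) (X Y : 'M[R[i]]_(u, s)) :
  0 <= P1 -> 0 < Rate -> gain H1 (H2 *m X) <= gain H1 (H2 *m Y) ->
  C_OSTBC P1 Rate H0 H1 H2 X <= C_OSTBC P1 Rate H0 H1 H2 Y.
Proof.
move=> P1_ge0 Rate_gt0; rewrite !C_OSTBC_gain.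
move: (gain_ge0 H1 (H2 *m X)) (gain_ge0 H1 (H2 *m Y)) (retr_gram_ge0 H0).
move: (gain _ _) (gain _ _) (retr _) => x y h x_ge0 y_ge0 h_ge0 xy.
have c_ge0 : 0 <= P1 / (t%:R * Rate).
  by rewrite divr_ge0 // mulr_ge0 ?ler0n // ltW.
have pos z : 0 <= z -> 1 + P1 / (t%:R * Rate) * (h + z) \is Num.pos.
  by move=> z_ge0; rewrite posrE ltr_wpDr // mulr_ge0 // addr_ge0.
rewrite ler_pM2l // /log2 ler_pM2r ?invr_gt0 ?ln_gt0 ?ltr1n //.
by rewrite ler_ln ?pos // lerD2l ler_wpM2l // lerD2l.
Qed.

Lemma relay_powerE u s (X : 'M[R[i]]_(u, s)) (U : 'M[R[i]]_s) (g : 'I_s -> R) :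
  (forall i, 0 <= g i) ->
  let Y := X *m U *m rdiag (fun i => Num.sqrt (g i)) in
  relay_power X (U *m rdiag g *m ctmx U) = retr (ctmx Y *m Y).
Proof.
move=> g_ge0 /=; set D := rdiag (fun i => Num.sqrt _).
have -> : rdiag g = D *m D.
  by rewrite rdiagM; apply: eq_rdiag => i; rewrite -expr2 sqr_sqrtr.
by rewrite /relay_power -/(retr _) [RHS]retrC !ctmxM ctmx_rdiag !mulmxA.
Qed.

End Selection.

(** * Optimality of the relay matrix built from eigenvectors *)

Theorem theorem2 (R : realType) (t s u r : nat) (P1 P2 : R)
  (H0 : 'M[R[i]]_(r, t)) (H1 : 'M[R[i]]_(s, t)) (H2 : 'M[R[i]]_(r, u))
  (ht : (0 < t)%N) (hs : (0 < s)%N) (hu : (0 < u)%N) (hr : (0 < r)%N)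
  (hP1 : 0 < P1) (hP2 : 0 < P2)
  (* eigen-decomposition of A = H1 H1^H *)
  (alpha : 'I_s -> R) (a : 'I_s -> 'cV[R[i]]_s)
  (halpha_sorted : forall i j : 'I_s, (i <= j)%N -> alpha j <= alpha i)
  (ha_orth : forall i j : 'I_s, ctmx (a i) *m a j = (i == j)%:R%:M)
  (ha_eig : forall i : 'I_s, (H1 *m ctmx H1) *m a i = (alpha i)%:C *: a i)
  (* positive eigenvalues of B = H2^H H2, rho_B = rank B *)
  (mu : 'I_(\rank (ctmx H2 *m H2)) -> R)
  (b : 'I_(\rank (ctmx H2 *m H2)) -> 'cV[R[i]]_u)
  (hmu_pos : forall i, 0 < mu i)
  (hmu_sorted : forall i j : 'I_(\rank (ctmx H2 *m H2)),
      (i <= j)%N -> mu j <= mu i)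
  (hb_orth : forall i j, ctmx (b i) *m b j = (i == j)%:R%:M)
  (hb_eig : forall i, (ctmx H2 *m H2) *m b i = (mu i)%:C *: b i)
  (* optimal solution x of the power-allocation problem, rho = min(s, rho_B) *)
  (x : 'I_(minn s (\rank (ctmx H2 *m H2))) -> R) :
  let rhoB := \rank (ctmx H2 *m H2) in
  let rho := minn s rhoB in
  let iA := fun i : 'I_rho => widen_ord (geq_minl s rhoB) i in
  let iB := fun i : 'I_rho => widen_ord (geq_minr s rhoB) i in
  let Cm := Cmat P1 H1 in
  let beta := fun i : 'I_rho =>
    complex.Re ((ctmx (a (iA i)) *m Cm *m a (iA i)) 0 0) / mu (iB i) in
  (forall i, 0 <= x i) ->
  \sum_(i < rho) beta i * x i <= P2 ->
  (forall y : 'I_rho -> R, (forall i, 0 <= y i) ->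
     \sum_(i < rho) beta i * y i <= P2 ->
     \sum_(i < rho) alpha (iA i) / (1 + x i) <=
     \sum_(i < rho) alpha (iA i) / (1 + y i)) ->
  let X0 := \sum_(i < rho)
     (Num.sqrt (x i / mu (iB i)))%:C *: (b (iB i) *m ctmx (a (iA i))) in
  relay_power X0 Cm <= P2 /\
  forall Rate : R, 0 < Rate ->
  forall X : 'M[R[i]]_(u, s), relay_power X Cm <= P2 ->
    C_OSTBC P1 Rate H0 H1 H2 X <= C_OSTBC P1 Rate H0 H1 H2 X0.
Proof.
move=> rhoB rho iA iB Cm beta x_ge0 x_feas x_opt X0.
pose U := colsmx a; pose W := colsmx b; pose B := ctmx H2 *m H2.
have UU : ctmx U *m U = 1%:M by exact: colsmx_orth.
have WW : ctmx W *m W = 1%:M by exact: colsmx_orth.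
have AE : H1 *m ctmx H1 = U *m rdiag alpha *m ctmx U.
  by rewrite -(colsmx_eig ha_eig) -mulmxA isometryC // mulmx1.
have BE : B = W *m rdiag mu *m ctmx W.
  apply: rank_spectral => //.
  - by rewrite /B ctmxM ctmxK.
  - by move=> i; rewrite gt_eqF.
  - exact: colsmx_eig.
have alpha_ge0 i : 0 <= alpha i.
  have : (ctmx (ctmx H1 *m U) *m (ctmx H1 *m U)) i i = (alpha i)%:C.
    rewrite ctmxM ctmxK mulmxA -(mulmxA (ctmx U)) AE !mulmxA UU mul1mx -mulmxA UU.
    by rewrite mulmx1 rdiagE eqxx.
  by rewrite gramE => /complexI <-; apply: sumr_ge0 => k _; exact: sqnorm_ge0.
pose c := P1 / t%:R.
have c_gt0 : 0 < c by rewrite divr_gt0 // ltr0n.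
pose g i := 1 + c * alpha i.
have g_ge1 i : 1 <= g i by rewrite lerDl mulr_ge0 // ltW.
have g_gt0 i : 0 < g i by apply: lt_le_trans (g_ge1 i).
have g_mono : nonincr g.
  by move=> i j ij; rewrite lerD2l ler_wpM2l ?halpha_sorted // ltW.
have CE : Cm = U *m rdiag g *m ctmx U.
  have -> : rdiag g = 1%:M + c%:C *: rdiag alpha.
    rewrite -rdiag1 -mul_scalar_mx -rdiag_const rdiagM rdiagD.
    by apply: eq_rdiag.
  by rewrite mulmxDr mulmxDl mulmx1 isometryC // -scalemxAr -scalemxAl -AE.
have betaE i : beta i = g (iA i) / mu (iB i).
  have Ca j : Cm *m a j = (g j)%:C *: a j.
    rewrite /Cm /Cmat mulmxDl mul1mx -scalemxAl ha_eig scalerA -{1}[a j]scale1r.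
    by rewrite -scalerDl -rmorphM /g rmorphD.
  by rewrite /beta -mulmxA Ca -scalemxAr ha_orth eqxx !mxE mulr1n mulr1.
pose D := rdiag (fun i => Num.sqrt (g i)).
pose Y (X : 'M[R[i]]_(u, s)) := X *m U *m D.
have gainYE X : gain H1 (H2 *m X) = \sum_i alpha i -
    retr (rdiag (fun i => alpha i * g i) *m
          invmx (rdiag g + ctmx (Y X) *m B *m Y X)).
  rewrite (gainE _ UU AE g_gt0) /=; congr (_ - retr (_ *m invmx (_ + _))).
  by rewrite /Y /B !ctmxM !mulmxA.
have powerYE X : relay_power X Cm = retr (ctmx (Y X) *m Y X).
  by rewrite CE relay_powerE // => i; exact: ltW.
have iA_inj : injective iA by move=> i j /(congr1 val) /= /val_inj.
have iB_inj : injective iB by move=> i j /(congr1 val) /= /val_inj.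
pose sg i := Num.sqrt (x i / mu (iB i)).
pose WB := colsmx (fun i => b (iB i)).
(* [K] selects the first [rho] eigenvectors: its entries are those of the identity cut to [rho]
   rows. *)
pose K := ctmx (colsmx (fun i => a (iA i))) *m U.
have YX0 : Y X0 = WB *m rdiag sg *m K *m D.
  by rewrite /Y /X0 colsmx_sum /K !mulmxA.
have KE i j : K i j = (iA i == j)%:R by rewrite colsmx_gram ha_orth mxE mulr1n.
have sgE i : sg i * sg i = x i / mu (iB i).
  by rewrite -expr2 sqr_sqrtr // divr_ge0 // ltW.
(* Extension by zero from the [rho] active modes to all [s] modes. *)
pose sel (h : 'I_rho -> R) j := \sum_i h i *+ (iA i == j).
have selE h i : sel h (iA i) = h i by exact: sum_selection.
have sel_out h (j : 'I_s) : ~~ (j < rho)%N -> sel h j = 0.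
  move=> jr; apply: big1 => i _; rewrite (_ : iA i == j = false) ?mulr0n //.
  by apply/negP => /eqP ij; move: jr; rewrite -ij /= ltn_ord.
(* Used with [Q = 1] for the power of [X0] and with [Q = B] for its gain. *)
have Ycongr (Q : 'M[R[i]]_u) (e : 'I_rho -> R) : ctmx WB *m Q *m WB = rdiag e ->
    ctmx (Y X0) *m Q *m Y X0 =
    rdiag (fun j => g j * sel (fun i => x i / mu (iB i) * e i) j).
  move=> QE.
  have -> : ctmx (Y X0) *m Q *m Y X0 =
     D *m (ctmx K *m (rdiag sg *m (ctmx WB *m Q *m WB) *m rdiag sg) *m K) *m D.
    by rewrite YX0 !ctmxM !ctmx_rdiag !mulmxA.
  rewrite QE !rdiagM (congr_selection _ KE) !rdiagM; apply: eq_rdiag => j.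
  rewrite mulrAC -expr2 sqr_sqrtr ?ltW //; congr (_ * _); apply: eq_bigr => i _.
  by rewrite mulrAC sgE.
have WBB : ctmx WB *m WB = 1%:M.
  by apply: colsmx_orth => i j; rewrite hb_orth (inj_eq iB_inj).
have WBE : ctmx WB *m B *m WB = rdiag (fun i => mu (iB i)).
  have BWB : B *m WB = WB *m rdiag (fun i => mu (iB i)) by exact: colsmx_eig.
  by rewrite -mulmxA BWB mulmxA WBB mul1mx.
split.
  rewrite powerYE -[ctmx (Y X0)]mulmx1 (Ycongr _ (fun=> 1)); last first.
    by rewrite mulmx1 WBB rdiag1.
  rewrite retr_rdiag (sum_widen (geq_minl s rhoB)) [X in _ + X]big1 ?addr0.
    apply: le_trans x_feas; apply: ler_sum => i _.
    by rewrite -/(iA i) selE betaE mulr1 mulrA mulrAC.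
  by move=> j jr; rewrite sel_out // mulr0.
move=> Rate Rate_gt0 X X_feas.
apply: (C_OSTBC_le H0 (ltW hP1) Rate_gt0).
rewrite !gainYE lerD2l lerN2.
(* Modes outside the first [rho] receive no power, and each contributes [alpha j] for [X0] and in
   the bound for [X] alike. *)
pose rest := \sum_(j < s | ~~ (j < rho)%N) alpha j.
apply: (@le_trans _ _ (\sum_(i < rho) alpha (iA i) / (1 + x i) + rest)).
  have sel_ge0 j : 0 <= sel x j.
    by apply: sumr_ge0 => i _; rewrite mulrn_wge0.
  have G_neq0 j : g j * (1 + sel x j) != 0.
    by rewrite gt_eqF // mulr_gt0 // ltr_wpDr.
  rewrite (Ycongr _ _ WBE) rdiagD.
  have -> : rdiag (fun j => g j + g j * sel (fun i => x i / mu (iB i) * mu (iB i)) j)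
      = rdiag (fun j => g j * (1 + sel x j)).
    apply: eq_rdiag => j; rewrite mulrDr mulr1; congr (_ + _ * _).
    by apply: eq_bigr => i _; rewrite divfK // gt_eqF.
  rewrite (invmx_eq (rdiagV G_neq0)) rdiagM retr_rdiag.
  rewrite (sum_widen (geq_minl s rhoB)); apply: lerD; apply: ler_sum => i.
    move=> _; rewrite -/(iA i) selE invfM mulrA mulfK //.
    by rewrite gt_eqF.
  by move=> ir; rewrite sel_out // addr0 mulr1 mulfK // gt_eqF.
have [V [m [VV mE m_mono m_ge0]]] := gram_spectral (H2 *m Y X).
have {}mE : ctmx (Y X) *m B *m Y X = V *m rdiag m *m ctmx V.
  by rewrite -mE ctmxM /B !mulmxA.
have := power_lower_bound (Y := Y X) WW hmu_pos hmu_sorted VV m_ge0 m_mono.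
rewrite -BE => /(_ mE) [m_out m_pow].
(* With [m = g y], [alpha g / (g + m)] becomes [alpha / (1 + y)] and [m / mu] becomes [beta y], so
   the power bound says that [y] is feasible. *)
pose y i := m (iA i) / g (iA i).
have y_ge0 i : 0 <= y i by rewrite divr_ge0 // ltW.
have y_feas : \sum_(i < rho) beta i * y i <= P2.
  rewrite powerYE in X_feas; apply: le_trans X_feas; apply: le_trans m_pow.
  apply: ler_sum => i _; rewrite betaE -/(iA i) -/(iB i) /y.
  rewrite le_eqVlt; apply/orP; left; apply/eqP; field.
  by rewrite !gt_eqF.
apply: (@le_trans _ _ (\sum_(i < rho) alpha (iA i) / (1 + y i) + rest)).
  by rewrite lerD2r; exact: x_opt.
(* The weight [alpha g] of the trace is [g^2 - g] up to the positive factor [c], which cancels. *)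
have gE i : g i ^+ 2 - g i = c * (alpha i * g i) by rewrite /g; ring.
rewrite mE; have := retr_weighted_inv_ge VV g_ge1 m_ge0 g_mono m_mono.
have -> : rdiag (fun i => g i ^+ 2 - g i) = c%:C *: rdiag (fun i => alpha i * g i).
  by rewrite -mul_scalar_mx -rdiag_const rdiagM; apply: eq_rdiag.
rewrite -scalemxAl retrZ.
have -> : \sum_i (g i ^+ 2 - g i) / (g i + m i) =
    c * \sum_i alpha i * g i / (g i + m i).
  by rewrite mulr_sumr; apply: eq_bigr => i _; rewrite gE !mulrA.
rewrite ler_pM2l //; apply: le_trans.
rewrite (sum_widen (geq_minl s rhoB)); apply: lerD; apply: ler_sum => i.
  move=> _; rewrite -/(iA i) /y le_eqVlt; apply/orP; left; apply/eqP.
  have [gi mi] := (g_gt0 (iA i), m_ge0 (iA i)).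
  by field; rewrite !gt_eqF //; lra.
(* An index below [s] but not below [rho] is at least [rhoB], where [m] vanishes. *)
move=> ir; rewrite m_out ?addr0 ?mulfK ?gt_eqF //.
by move: ir (ltn_ord i); rewrite /rho; lia.
Qed.
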